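(* For any edge-discriminator $\lambda$ on a hypergraph $\mathcal H=(\mathcal V,\mathcal E)$ with $|\mathcal E|=n\ge 1$, one has $$\omega_\lambda(\mathcal V)\ge\max\left\{n,\ \frac{\delta(\delta+1)}{2}\right\},$$ where $\delta$ is the size of a maximum matching of $\mathcal H$. Moreover, for every $n\ge 1$ there is a hypergraph with $n$ hyperedges which attains this bound, i.e. which has an edge-discriminator of weight exactly $\max\{n,\delta(\delta+1)/2\}$.
   Context: A hypergraph is a pair $\mathcal H=(\mathcal V,\mathcal E)$ where $\mathcal V$ is a finite set (vertices) and $\mathcal E$ is a collection of (pairwise distinct) nonempty subsets of $\mathcal V$ (hyperedges). A matching is a subset $\mathcal E'\subseteq\mathcal E$ whose elements are mutually disjoint; a maximum matching is a matching of largest size. An edge-discriminator on $\mathcal H$ is a function $\lambda:\mathcal V\to\mathbb Z^{+}\cup\{0\}$ such that $\sum_{v\in E}\lambda(v)>0$ for every $E\in\mathcal E$, and $\sum_{v\in E}\lambda(v)\ne\sum_{v\in E'}\lambda(v)$ for every two distinct $E,E'\in\mathcal E$. Its weight is $\omega_\lambda(\mathcal V)=\sum_{v\in\mathcal V}\lambda(v)$. *)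

(* Defs.v *)
From mathcomp Require Import all_boot.

Set Implicit Arguments.
Unset Strict Implicit.
Unset Printing Implicit Defensive.

Record hypergraph := Hypergraph {
  vertices : finType;
  hyperedges : {set {set vertices}};
  hyperedges_neq0 : set0 \notin hyperedges
}.

Definition matching (H : hypergraph) (M : {set {set vertices H}}) : bool :=
  (M \subset hyperedges H) && trivIset M.

Definition matching_number (H : hypergraph) : nat :=
  \max_(M : {set {set vertices H}} | matching M) #|M|.

Definition edge_discriminator (H : hypergraph) (lambda : vertices H -> nat) : Prop :=
  (forall E, E \in hyperedges H -> 0 < \sum_(v in E) lambda v) /\
  (forall E E', E \in hyperedges H -> E' \in hyperedges H -> E <> E' ->
     \sum_(v in E) lambda v <> \sum_(v in E') lambda v).

Definition weight (H : hypergraph) (lambda : vertices H -> nat) : nat :=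
  \sum_(v : vertices H) lambda v.

(* The division by 2 is exact, [d * d.+1] being even. *)
Definition weight_bound (n d : nat) : nat := maxn n ((d * d.+1) %/ 2).

(* Main.v *)
(* Distinct positive integers: n of them have maximum at least n, hence
   (removing the maximum and inducting) sum at least 1 + ... + n. Apply the
   first fact to the weights of all hyperedges, and the second to those of a
   maximum matching, whose members have total weight at most that of the
   vertex set.  Equality holds for the chain of initial segments of
   {0, ..., n-1}, with all labels 1: it has total weight n and no two
   disjoint hyperedges. *)
Require Import Defs.
From mathcomp Require Import all_boot.

Set Implicit Arguments.
Unset Strict Implicit.
Unset Printing Implicit Defensive.

(** Pigeonhole: the values of [f] on [A] form a duplicate-free list contained in [iota 1 w]. *)
Lemma leq_card_pos_inj (T : finType) (A : {set T}) (f : T -> nat) (w : nat) :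
  {in A &, injective f} -> {in A, forall x, 0 < f x <= w} -> #|A| <= w.
Proof.
move=> injf fw; rewrite cardE -(size_map f) -(size_iota 1 w).
apply: uniq_leq_size.
  by rewrite map_inj_in_uniq ?enum_uniq // => x y; rewrite !mem_enum; apply: injf.
move=> _ /mapP[x + ->]; rewrite mem_enum => /fw.
by rewrite mem_iota add1n ltnS.
Qed.

(** The doubled form keeps division out of the induction on the size of [A]. *)
Lemma leq_triangle_sum_pos_inj (T : finType) (A : {set T}) (f : T -> nat) :
  {in A &, injective f} -> {in A, forall x, 0 < f x} ->
  #|A| * #|A|.+1 <= (\sum_(x in A) f x).*2.
Proof.
have [n] := ubnP #|A|; elim: n A => // n IHn A ltAn injf f_gt0.
have [-> | [x0 Ax0]] := set_0Vmem A; first by rewrite cards0.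
have [x Ax max_x] : exists2 x, x \in A & {in A, forall y, f y <= f x}.
  by have [x] := @arg_maxnP _ x0 [in A] f Ax0; exists x.
have leAx : #|A| <= f x.
  by apply: leq_card_pos_inj injf _ => y Ay; rewrite f_gt0 ?max_x.
have cardA : #|A| = #|A :\ x|.+1 by rewrite (cardsD1 x A) Ax.
have sub : {subset A :\ x <= A} by apply/subsetP/subsetDl.
have ltAxn : #|A :\ x| < n by rewrite -ltnS -cardA.
have {IHn} IH := IHn _ ltAxn (sub_in2 sub injf) (sub_in1 sub f_gt0).
rewrite (big_setD1 x) //= doubleD.
(* With [k = #|A :\ x|], this rests on [(k+1)(k+2) = 2(k+1) + k(k+1)]: the maximum [f x] pays for
   the first summand, [IH] for the second. *)
apply: leq_trans (leq_add (_ : #|A|.*2 <= _) IH); last by rewrite leq_double.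
by rewrite cardA -muln2 -[X in _ <= _ + X]mulnC -mulnDr addnC addn2.
Qed.

Section LowerBound.

Variables (H : hypergraph) (lambda : vertices H -> nat).
Hypothesis lambdaP : edge_discriminator lambda.

Let edge_weight (E : {set vertices H}) := \sum_(v in E) lambda v.

(** [E] ranges over all vertex sets because the bound is also applied to the union of a matching,
    which need not be a hyperedge. *)
Lemma edge_weight_le_weight (E : {set vertices H}) :
  edge_weight E <= weight lambda.
Proof. by rewrite /weight (bigID (mem E)) /= leq_addr. Qed.

Lemma edge_weight_inj : {in hyperedges H &, injective edge_weight}.
Proof.
move=> E E' HE HE' eqw; apply/eqP/negPn/negP => /eqP neqE.
by case: lambdaP => _ /(_ _ _ HE HE' neqE).
Qed.

Lemma card_hyperedges_le_weight : #|hyperedges H| <= weight lambda.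
Proof.
apply: leq_card_pos_inj edge_weight_inj _ => E HE.
by rewrite (proj1 lambdaP) ?edge_weight_le_weight.
Qed.

Lemma matching_triangle_le_weight (M : {set {set vertices H}}) :
  matching M -> (#|M| * #|M|.+1) %/ 2 <= weight lambda.
Proof.
case/andP=> /subsetP sMH trivM.
have trianM : #|M| * #|M|.+1 <= (\sum_(E in M) edge_weight E).*2.
  apply: leq_triangle_sum_pos_inj; first exact: (sub_in2 sMH edge_weight_inj).
  by move=> E /sMH; apply: (proj1 lambdaP).
apply: leq_trans (leq_div2r 2 trianM) _.
(* By disjointness, the weights of the members of [M] add up to the weight of [cover M]. *)
rewrite -muln2 mulnK // -(big_trivIset _ trivM).
exact: edge_weight_le_weight.
Qed.

Lemma weight_bound_le_weight :
  weight_bound #|hyperedges H| (matching_number H) <= weight lambda.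
Proof.
rewrite /weight_bound geq_max card_hyperedges_le_weight /=.
(* Since some matching exists, the maximum defining [matching_number H] is attained by a
   matching. *)
have m0 : matching (set0 : {set {set vertices H}}).
  by rewrite /matching sub0set; apply/trivIsetP => E E'; rewrite inE.
rewrite /matching_number (bigmax_eq_arg set0) //.
by case: arg_maxnP => // M /matching_triangle_le_weight.
Qed.

End LowerBound.

Section ChainHypergraph.

Variable m : nat.

Definition initial_segment (i : 'I_m.+1) : {set 'I_m.+1} :=
  [set j : 'I_m.+1 | j <= i].

Definition initial_segments : {set {set 'I_m.+1}} :=
  [set initial_segment i | i : 'I_m.+1].

Lemma card_initial_segment i : #|initial_segment i| = i.+1.
Proof.
rewrite -sum1_card (eq_bigl (fun j : 'I_m.+1 => j < i.+1)); last first.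
  by move=> j; rewrite inE.
by rewrite -(big_ord_widen _ (fun=> 1)) // sum_nat_const card_ord muln1.
Qed.

Lemma initial_segment_inj : injective initial_segment.
Proof.
move=> i j eqS; apply/val_inj/succn_inj.
by rewrite -!card_initial_segment eqS.
Qed.

Lemma set0_notin_initial_segments : set0 \notin initial_segments.
Proof.
apply/imsetP => -[i _] /(congr1 (fun A : {set _} => #|A|)).
by rewrite cards0 card_initial_segment.
Qed.

Definition chain_hypergraph : hypergraph :=
  Hypergraph set0_notin_initial_segments.

Lemma card_chain_hyperedges : #|hyperedges chain_hypergraph| = m.+1.
Proof. by rewrite card_imset ?card_ord //; apply: initial_segment_inj. Qed.

Lemma matching_number_chain : matching_number chain_hypergraph <= 1.
Proof.
apply/bigmax_leqP => M /andP[/subsetP sM /trivIsetP trivM].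
apply/card_le1_eqP => E E' ME ME'; apply/eqP; apply: contraT => neqE.
(* Every initial segment contains [ord0], so no two are disjoint. *)
have /pred0P/(_ ord0) := trivM _ _ ME' ME neqE.
case/imsetP: (sM _ ME) => i _ ->; case/imsetP: (sM _ ME') => j _ ->.
by rewrite /= !inE.
Qed.

Lemma chain_discriminator :
  @edge_discriminator chain_hypergraph (fun=> 1).
Proof.
split=> [_ /imsetP[i _ ->] | _ _ /imsetP[i _ ->] /imsetP[j _ ->] neqS].
  by rewrite sum1_card card_initial_segment.
rewrite !sum1_card !card_initial_segment => /succn_inj/val_inj eqij.
by rewrite eqij in neqS.
Qed.

Lemma weight_chain : @weight chain_hypergraph (fun=> 1) = m.+1.
Proof. by rewrite /weight sum1_card card_ord. Qed.

End ChainHypergraph.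

Theorem theorem4p1 :
  (forall (H : hypergraph) (n : nat) (lambda : vertices H -> nat),
     0 < n -> #|hyperedges H| = n -> edge_discriminator lambda ->
     weight_bound n (matching_number H) <= weight lambda) /\
  (forall n : nat, 0 < n ->
     exists (H : hypergraph) (lambda : vertices H -> nat),
       [/\ #|hyperedges H| = n,
           edge_discriminator lambda &
           weight lambda = weight_bound n (matching_number H)]).
Proof.
split=> [H n lambda _ <- | [//|m] _]; first exact: weight_bound_le_weight.
exists (chain_hypergraph m), (fun=> 1); split.
- exact: card_chain_hyperedges.
- exact: chain_discriminator.
rewrite weight_chain /weight_bound.
(* The matching number is 0 or 1, so the triangular term is at most 1 and the maximum is [m.+1]. *)
by case: matching_number (matching_number_chain m) => [|[|]].
Qed.
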